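(* Let $a>1$, let $0<c_1\le c_2$, and let $K\ge1$. There exists a constant $C>0$ depending only on $a,c_1,c_2,K$ such that for every $d\ge1$, every symmetric positive definite $H\in\mathbb{R}^{d\times d}$ whose eigenvalues $\lambda_1\ge\dots\ge\lambda_d>0$ satisfy $c_1 i^{-a}\le\lambda_i\le c_2 i^{-a}$ for all $i\in\{1,\dots,d\}$, and every integer mini-batch size $B\ge1$, the optimal ASGD spectral radius $s^*(H,B)$ satisfies: (i) if $B\le K$, then $s^*(H,B)\ge 1-C\,B\,d^{-\frac{a^2}{2a-1}}$; (ii) if $K^{-1}\le B\le K d^{1/2}$, then $s^*(H,B)\ge 1-C\,B^{\frac{a}{2a-1}}\,d^{-\frac{a^2}{2a-1}}$; (iii) if $B\ge K^{-1}d^{1/2}$, then $s^*(H,B)\ge 1-C\,d^{-a/2}$. In particular, the lower bound saturates at the accelerated scale (i.e. the gap bound in (ii) reaches the order $d^{-a/2}$ of the gap bound in (iii)) at batch size of order $B^{\mathrm{crit}}_{\mathrm{ASGD}}\asymp d^{1/2}$.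
   Context: Let $H\in\mathbb{R}^{d\times d}$ be symmetric positive definite with eigenvalues $\lambda_1\ge\dots\ge\lambda_d>0$ and let $\Lambda=\mathrm{diag}(\lambda_1,\dots,\lambda_d)$. For a step size $\eta>0$, a momentum parameter $\beta\in[0,1)$, a gradient weight $\zeta>0$ and a batch size $B$, define the $2d\times2d$ matrix (in $d\times d$ blocks) $$A=\begin{bmatrix}(1+\beta)I-\eta(\zeta+1-\beta)\Lambda & -\beta I\\ I-\eta\zeta\Lambda & 0\end{bmatrix}.$$ The accelerated SGD (ASGD) covariance operator $\mathcal{T}_{H,\eta,\beta,\zeta,B}$ is the linear map on the space of real symmetric $2d\times2d$ matrices given by $$\mathcal{T}_{H,\eta,\beta,\zeta,B}(S)=A\,S\,A^\top+\frac{\eta^2}{B}\,\mathrm{Tr}(\Lambda S^{11})\begin{bmatrix}(\zeta+1-\beta)^2\Lambda & \zeta(\zeta+1-\beta)\Lambda\\ \zeta(\zeta+1-\beta)\Lambda & \zeta^2\Lambda\end{bmatrix},$$ where $S^{11}$ is the upper-left $d\times d$ block of $S$. Its spectral radius (maximal modulus of its complex eigenvalues) is $s(H,\eta,\beta,\zeta,B)=\rho(\mathcal{T}_{H,\eta,\beta,\zeta,B})$, and $$s^*(H,B)=\inf_{\eta>0,\ \beta\in[0,1),\ \zeta>0}s(H,\eta,\beta,\zeta,B).$$ *)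

(* Defs.v *)
From HB Require Import structures.
From mathcomp Require Import all_boot all_order all_algebra.
From mathcomp Require Import complex.
From mathcomp Require Import all_classical all_reals all_analysis.

Set Implicit Arguments.
Unset Strict Implicit.
Unset Printing Implicit Defensive.

Import Order.TTheory GRing.Theory Num.Theory.

Local Open Scope classical_set_scope.
Local Open Scope ring_scope.

Definition posdef (R : realType) (d : nat) (H : 'M[R]_d) : Prop :=
  H^T = H /\ forall v : 'rV[R]_d, v != 0 -> 0 < (v *m H *m v^T) 0 0.

(* Eigenvalues are listed with multiplicity; the index i : 'I_d is 0-based. *)
Definition ordered_eigenvalues (R : realType) (d : nat) (H : 'M[R]_d)
    (lam : 'rV[R]_d) : Prop :=
  char_poly H = \prod_(i < d) ('X - (lam 0 i)%:P) /\
  forall i j : 'I_d, (i <= j)%N -> lam 0 j <= lam 0 i.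

(* At most one vector satisfies [ordered_eigenvalues H]; the default 0 is only
   used for a matrix whose characteristic polynomial does not split over R,
   hence never for a symmetric one. *)
Definition spectrum (R : realType) (d : nat) (H : 'M[R]_d) : 'rV[R]_d :=
  xget 0 [set lam | ordered_eigenvalues H lam].

Definition symmetric_space (R : realType) (n : nat) : {vspace 'M[R]_n} :=
  lker (linfun (fun S : 'M[R]_n => S^T - S)).

Lemma mem_symmetric_space (R : realType) (n : nat) (S : 'M[R]_n) :
  (S \in symmetric_space R n) = (S^T == S).
Proof.
have lin : linear (fun S : 'M[R]_n => S^T - S).
  by move=> a U V /=; rewrite linearP /= scalerBr opprD addrACA.
pose f := HB.pack_for {linear 'M[R]_n -> 'M[R]_n} (fun S : 'M[R]_n => S^T - S)
  (GRing.isLinear.Build R 'M[R]_n 'M[R]_n _ (fun S : 'M[R]_n => S^T - S) lin).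
by rewrite memv_ker (lfunE f) /= subr_eq0.
Qed.

(* The matrix of f in a basis of the real space V, read over R[i]; its
   eigenvalues do not depend on the basis. *)
Definition complex_eigenvalue (R : realType) (V : vectType R) (f : 'End(V))
    (z : R[i]) : bool :=
  eigenvalue
    (map_mx (real_complex R) (passmx.mxof (vbasis fullv) (vbasis fullv) f)) z.

Definition spectral_radius (R : realType) (V : vectType R) (f : 'End(V)) : R :=
  sup [set complex.Re `|z| | z in [set z : R[i] | complex_eigenvalue f z]].

Definition asgd_matrix (R : realType) (d : nat) (lam : 'rV[R]_d)
    (eta beta zeta : R) : 'M[R]_(d + d) :=
  block_mx
    ((1 + beta)%:M - (eta * (zeta + 1 - beta)) *: diag_mx lam) (- beta%:M)
    (1%:M - (eta * zeta) *: diag_mx lam)                       0.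

Definition asgd_noise (R : realType) (d : nat) (lam : 'rV[R]_d)
    (beta zeta : R) : 'M[R]_(d + d) :=
  block_mx
    ((zeta + 1 - beta) ^+ 2 *: diag_mx lam)
    ((zeta * (zeta + 1 - beta)) *: diag_mx lam)
    ((zeta * (zeta + 1 - beta)) *: diag_mx lam)
    (zeta ^+ 2 *: diag_mx lam).

Definition asgd_map (R : realType) (d : nat) (lam : 'rV[R]_d)
    (eta beta zeta : R) (B : nat) (S : 'M[R]_(d + d)) : 'M[R]_(d + d) :=
  let A := asgd_matrix lam eta beta zeta in
  A *m S *m A^T
  + (eta ^+ 2 / B%:R * \tr (diag_mx lam *m ulsubmx S))
      *: asgd_noise lam beta zeta.

Lemma asgd_map_linear (R : realType) (d : nat) (lam : 'rV[R]_d)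
    (eta beta zeta : R) (B : nat) : linear (asgd_map lam eta beta zeta B).
Proof.
move=> a U V; rewrite /asgd_map /=.
have -> : ulsubmx (a *: U + V) = a *: ulsubmx U + ulsubmx V.
  by apply/matrixP => i j; rewrite !mxE.
rewrite !mulmxDr mulmxDl -!scalemxAr -scalemxAl mxtraceD mxtraceZ.
rewrite mulrDr scalerDl scalerDr addrACA; congr (_ + _ + _).
by rewrite scalerA mulrCA.
Qed.

Lemma asgd_map_sym (R : realType) (d : nat) (lam : 'rV[R]_d)
    (eta beta zeta : R) (B : nat) (S : 'M[R]_(d + d)) :
  S^T = S ->
  (asgd_map lam eta beta zeta B S)^T = asgd_map lam eta beta zeta B S.
Proof.
move=> symS; rewrite /asgd_map linearD /= linearZ /= !trmx_mul trmxK symS mulmxA.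
congr (_ + _ *: _).
by rewrite /asgd_noise tr_block_mx !linearZ /= tr_diag_mx.
Qed.

(* [asgd_map] preserves symmetric matrices, so [vsproj] does not alter its
   value here; see [asgd_opE]. *)
Definition asgd_op (R : realType) (d : nat) (lam : 'rV[R]_d)
    (eta beta zeta : R) (B : nat) :
    'End(subvs_of (symmetric_space R (d + d))) :=
  linfun (fun S : subvs_of (symmetric_space R (d + d)) =>
    vsproj (symmetric_space R (d + d))
      (asgd_map lam eta beta zeta B (vsval S))).

Lemma asgd_opE (R : realType) (d : nat) (lam : 'rV[R]_d)
    (eta beta zeta : R) (B : nat)
    (S : subvs_of (symmetric_space R (d + d))) :
  vsval (asgd_op lam eta beta zeta B S)
  = asgd_map lam eta beta zeta B (vsval S).
Proof.
set g := fun S : subvs_of (symmetric_space R (d + d)) =>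
  vsproj (symmetric_space R (d + d)) (asgd_map lam eta beta zeta B (vsval S)).
have lin : linear g.
  by move=> a U V; rewrite /g linearP asgd_map_linear linearP.
pose f := HB.pack_for
  {linear subvs_of (symmetric_space R (d + d))
          -> subvs_of (symmetric_space R (d + d))} g
  (GRing.isLinear.Build R _ _ _ g lin).
rewrite /asgd_op -/g (lfunE f) /= /g vsprojK //.
rewrite mem_symmetric_space; apply/eqP/asgd_map_sym/eqP.
by rewrite -mem_symmetric_space subvsP.
Qed.

Definition asgd_radius (R : realType) (d : nat) (H : 'M[R]_d)
    (eta beta zeta : R) (B : nat) : R :=
  spectral_radius (asgd_op (spectrum H) eta beta zeta B).

Definition asgd_opt_radius (R : realType) (d : nat) (H : 'M[R]_d)
    (B : nat) : R :=
  inf [set s | exists eta beta zeta : R,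
         [/\ 0 < eta, 0 <= beta < 1, 0 < zeta
           & s = asgd_radius H eta beta zeta B]].

(* f and g are of the same order as functions of the dimension d >= 1. *)
Definition same_order (R : realType) (f g : nat -> R) : Prop :=
  exists2 M : R, 0 < M &
    forall d : nat, (0 < d)%N -> M^-1 * g d <= f d <= M * g d.

(* Main.v *)
(* The noise term is a rank-one positive perturbation of S |-> A S A^T, so on a
   z-axis free of eigenvalues the two characteristic polynomials differ by the
   factor 1 - phi(S_z), with S_z the resolvent of S |-> A S A^T applied to the
   noise matrix and phi the noise gain.  Since phi(S_z) >= 0, a radius
   rho < 1 - e forces that S |-> A S A^T has no real eigenvalue >= 1 - e and
   that phi(S_1) < 1.  Both conditions decouple over the eigenvalues of Lambda.
   With om = 1 - beta, the first gives for the extreme modes eta zeta lam_1 < 2,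
   eta om lam_1 < 4, e <= 8 eta lam_d and e = O(om), whence e^2 = O(lam_d); the
   second gives
     sum_j eta lam_j om / (om + eta zeta lam_j) <= 8 B,
   and keeping the m largest eigenvalues, m ~ e^(-1/a), yields
   e^(2 - 1/a) = O(B d^(-a)). *)
Require Import Defs.
From HB Require Import structures.
From mathcomp Require Import all_boot all_order all_algebra.
From mathcomp Require Import complex polyrcf.
From mathcomp Require Import all_classical all_reals all_analysis.
From mathcomp Require Import ring lra.
Import Order.TTheory GRing.Theory Num.Theory passmx.
Local Open Scope ring_scope.

(** * Rank-one perturbations and real eigenvalues *)

(** The bordered matrix [X] has two Schur complements, and both compute its determinant. *)
Lemma det_sub_rank_one {F : comNzRingType} n (c : 'cV[F]_n) (s : 'rV[F]_n) :
  \det (1%:M - c *m s) = 1 - (s *m c) 0 0.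
Proof.
pose X := block_mx (1%:M : 'M[F]_n) c s (1%:M : 'M[F]_1).
have E1 : X = block_mx 1%:M 0 s 1%:M *m block_mx 1%:M c 0 (1%:M - s *m c).
  by rewrite mulmx_block !mul1mx !mul0mx !mulmx1 !addr0 addrC subrK.
have E2 : X = block_mx 1%:M c 0 1%:M *m block_mx (1%:M - c *m s) 0 s 1%:M.
  by rewrite mulmx_block !mul1mx !mul0mx !mulmx1 !add0r subrK.
have := congr1 determinant E2.
rewrite E1 !det_mulmx !(det_ublock, det_lblock) !det1 !mul1r mulr1 => <-.
by rewrite [X in \det X]mx11_scalar det_scalar1 !mxE.
Qed.

Lemma horner_char_poly {F : comNzRingType} n (A : 'M[F]_n) (z : F) :
  (char_poly A).[z] = \det (z%:M - A).
Proof.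
rewrite /char_poly -horner_evalE -det_map_mx; congr (\det _).
apply/matrixP => i j; rewrite !mxE /= /horner_eval !hornerE.
by rewrite hornerMn hornerX.
Qed.

(** A monic polynomial is positive far to the right, so a value at most 0 at [r] would force a root
    beyond [r] by the intermediate value theorem. *)
Lemma monic_gt0 {R : rcfType} (p : {poly R}) (r : R) :
  p \is monic -> (forall z, r <= z -> ~~ root p z) -> 0 < p.[r].
Proof.
move=> pm nr.
have lp : 0 < lead_coef p by rewrite (monicP pm).
have [n hn] := poly_pinfty_gt_lc lp.
pose m := Num.max n r.
have pm0 : 0 < p.[m] by apply: lt_le_trans lp _; apply: hn; rewrite le_max lexx.
have rm : r <= m by rewrite le_max lexx orbT.
rewrite ltNge; apply/negP => pr.
have [|z /andP[rz _] rootz] := @poly_ivt R p r m rm; first by rewrite pr ltW.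
by have := nr z rz; rewrite rootz.
Qed.

Lemma largest_root {R : rcfType} (p : {poly R}) (r z0 : R) :
  p != 0 -> r <= z0 -> root p z0 ->
  exists z1, [/\ r <= z1, root p z1 & forall z, z1 < z -> ~~ root p z].
Proof.
move=> pn0 rz0 pz0.
have h z : (z \in rootsR p) = root p z by rewrite -roots_on_rootsR // in_itv.
have z0s : z0 \in rootsR p by rewrite h.
have [z1 z1s max1] : exists2 z1, z1 \in rootsR p & {in rootsR p, forall z, z <= z1}.
  elim: (rootsR p) z0 z0s {h rz0 pz0} => // x s IH _ _.
  case: s IH => [_|y s IH].
    by exists x; [rewrite mem_head|move=> z; rewrite inE => /eqP ->].
  have [w ws hw] := IH y (mem_head _ _).
  have [xw|wx] := leP x w.
    exists w; first by rewrite inE ws orbT.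
    by move=> z; rewrite inE => /orP[/eqP -> //|]; apply: hw.
  exists x; first exact: mem_head.
  by move=> z; rewrite inE => /orP[/eqP -> //|/hw/le_trans -> //]; apply: ltW.
exists z1; split; first exact: le_trans rz0 (max1 _ z0s).
  by rewrite -h.
by move=> z z1z; rewrite -h; apply/negP => /max1; rewrite leNgt z1z.
Qed.

Lemma horner_ge0_at_left {R : rcfType} (p : {poly R}) (z1 : R) :
  (forall z, z1 < z -> 0 <= p.[z]) -> 0 <= p.[z1].
Proof.
move=> h; rewrite leNgt; apply/negP => neg.
have [|e e0 he] := @poly_cont R z1 p (- p.[z1]); first by rewrite oppr_gt0.
have y1 : z1 < z1 + e / 2 by rewrite ltrDl divr_gt0.
have := he (z1 + e / 2); have := h _ y1.
have -> : z1 + e / 2 - z1 = e / 2 by ring.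
rewrite gtr0_norm ?divr_gt0 // => py /(_ ltac:(lra)).
by rewrite ltr_norml; lra.
Qed.

(** The basis is that of [complex_eigenvalue], but the coefficients stay real, since the arguments
    below use order and continuity along the real axis. *)
Definition lfun_char_poly {F : fieldType} {V : vectType F} (f : 'End(V)) :
    {poly F} :=
  char_poly (mxof (vbasis fullv) (vbasis fullv) f).

Lemma root_lfun_char_poly {F : fieldType} {V : vectType F} (f : 'End(V))
    (z : F) (v : V) :
  v != 0 -> f v = z *: v -> root (lfun_char_poly f) z.
Proof.
move=> vn0 fv; rewrite -eigenvalue_root_char; apply/eigenvalueP.
exists (rVof (vbasis fullv) v).
  by rewrite -rVof_app ?vbasisP // fv linearZ.
by rewrite rVof_eq0 ?vbasisP.
Qed.

(** If (z - g) S = n, then z - f = (z - g) (1 - S phi), and the second factor has determinant 1 -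
    phi S. A preimage [S] of [n] thus replaces the inverse of z - g. *)
Lemma lfun_char_poly_rank_one {F : fieldType} {V : vectType F} (f g : 'End(V))
    (phi : {scalar V}) (n S : V) (z : F) :
  (forall v, f v = g v + phi v *: n) -> z *: S - g S = n ->
  (lfun_char_poly f).[z] = (lfun_char_poly g).[z] * (1 - phi S).
Proof.
move=> fE zS; rewrite !horner_char_poly.
set e := vbasis fullv; have eb : basis_of fullv e := vbasisP _.
pose c : 'cV_(\dim {:V}) := \col_i phi e`_i; pose s := rVof e S.
have phiE v : (rVof e v *m c) 0 0 = phi v.
  rewrite [in RHS](coord_basis eb (memvf v)) linear_sum mxE.
  by apply: eq_bigr => i _; rewrite !mxE scalarZ.
have gE : rVof e n = s *m (z%:M - mxof e e g).
  by rewrite -zS linearB linearZ /= (rVof_app _ eb) // mulmxBr mul_mx_scalar.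
have -> : mxof e e f = mxof e e g + c *m rVof e n.
  apply/row_matrixP => i; rewrite !rowE mulmxDr !mul_mxof fE linearD.
  rewrite linearZ /= mulmxA; congr (_ + _).
  rewrite [X in X *m rVof _ _]mx11_scalar mul_scalar_mx; congr (_ *: _).
  by rewrite -phiE vecofK.
rewrite gE opprD addrA mulmxA -[X in X - _]mul1mx -mulmxBl det_mulmx.
by rewrite det_sub_rank_one phiE mulrC.
Qed.

(** A positive rank-one perturbation cannot lower the largest real root. The resolvent condition is
    asked only beyond every real root of [g], which is where the explicit solution can be shown to
    have nonnegative gain. *)
Lemma rank_one_no_large_root {R : rcfType} {V : vectType R} (f g : 'End(V))
    (phi : {scalar V}) (n : V) (r : R) :
  (forall v, f v = g v + phi v *: n) ->
  (forall z, r <= z -> ~~ root (lfun_char_poly f) z) ->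
  (forall z, r <= z -> (forall y, z <= y -> ~~ root (lfun_char_poly g) y) ->
     exists2 S, z *: S - g S = n & 0 <= phi S) ->
  forall z, r <= z -> ~~ root (lfun_char_poly g) z.
Proof.
move=> fE fr gS z0 rz0; apply/negP => gz0.
have fm : lfun_char_poly f \is monic by exact: char_poly_monic.
have gm : lfun_char_poly g \is monic by exact: char_poly_monic.
have [z1 [rz1 gz1 z1max]] := largest_root _ _ _ (monic_neq0 gm) rz0 gz0.
(* Beyond the largest root z1 of g, f's polynomial is dominated by g's; in the
   limit it is nonpositive at z1, although it is positive on [r, +oo[. *)
have : 0 <= (lfun_char_poly g - lfun_char_poly f).[z1].
  apply: horner_ge0_at_left => z z1z.
  have gy y : z <= y -> ~~ root (lfun_char_poly g) y.
    by move=> zy; apply: z1max; apply: lt_le_trans zy.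
  have [S SE S0] := gS z (le_trans rz1 (ltW z1z)) gy.
  rewrite hornerD hornerN (lfun_char_poly_rank_one f g phi n S z fE SE).
  rewrite mulrBr mulr1 subKr mulr_ge0 //.
  exact: ltW (monic_gt0 _ _ gm gy).
rewrite hornerD hornerN (eqP gz1) sub0r oppr_ge0 leNgt => /negP; apply.
by apply: (monic_gt0 _ _ fm) => z z1z; apply: fr; apply: le_trans z1z.
Qed.

(** Both characteristic polynomials are positive at [r], hence so is their ratio 1 - phi S. *)
Lemma rank_one_functional_lt1 {R : rcfType} {V : vectType R} (f g : 'End(V))
    (phi : {scalar V}) (n S : V) (r : R) :
  (forall v, f v = g v + phi v *: n) ->
  (forall z, r <= z -> ~~ root (lfun_char_poly f) z) ->
  (forall z, r <= z -> ~~ root (lfun_char_poly g) z) ->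
  r *: S - g S = n -> phi S < 1.
Proof.
move=> fE fr gr SE.
have f0 := monic_gt0 (lfun_char_poly f) r (char_poly_monic _) fr.
have g0 := monic_gt0 (lfun_char_poly g) r (char_poly_monic _) gr.
by move: f0; rewrite (lfun_char_poly_rank_one f g phi n S r fE SE) pmulr_rgt0 // subr_gt0.
Qed.

Lemma spectral_radius_ge {R : realType} {V : vectType R} (f : 'End(V)) (z : R) :
  root (lfun_char_poly f) z -> `|z| <= spectral_radius f.
Proof.
move=> fz; apply: ub_le_sup; last first.
  exists z%:C%C; last by rewrite normc_def /= expr0n addr0 sqrtr_sqr.
  by rewrite /= /complex_eigenvalue eigenvalue_root_char -map_char_poly fmorph_root.
pose p := char_poly (map_mx (real_complex R)
  (mxof (vbasis fullv) (vbasis fullv) f)).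
have [rs prs] := closed_field_poly_normal p.
(* The supremum must be over a bounded set; the sum of the moduli of all complex roots is a crude
   bound. *)
exists (\sum_(w <- rs) complex.Re `|w|) => _ [w fw <-].
have wrs : w \in rs.
  move: fw; rewrite /= /complex_eigenvalue eigenvalue_root_char -/p prs.
  by rewrite (monicP (char_poly_monic _)) scale1r root_prod_XsubC.
rewrite (big_rem w wrs) /= lerDl sumr_ge0 // => v _.
by case: v => x y; rewrite /= sqrtr_ge0.
Qed.

Lemma spectral_radius_ge0 {R : realType} {V : vectType R} (f : 'End(V)) :
  0 <= spectral_radius f.
Proof.
rewrite /spectral_radius; set A := (X in sup X).
(* [sup] is 0 by default on an empty or unbounded set; otherwise it dominates some modulus. *)
have [[x Ax]|/nonemptyPn A0] := pselect (A !=set0)%classic; last by rewrite A0 sup0.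
have [ubA|nub] := pselect (has_ubound A); last by rewrite sup_out // => -[].
apply: le_trans (ub_le_sup ubA Ax).
by case: Ax => -[x' y] _ <-; rewrite /= sqrtr_ge0.
Qed.

(** * The ASGD operator on block-diagonal covariances *)

(** Up to a permutation of coordinates, this is a direct sum of 2 by 2 symmetric blocks, one for
    each eigenvalue of Lambda. The noise has this shape and the noiseless map preserves it. *)
Definition diag_block {R : realType} {d} (p q s : 'rV[R]_d) : 'M[R]_(d + d) :=
  block_mx (diag_mx p) (diag_mx q) (diag_mx q) (diag_mx s).

(* The restriction of the ASGD matrix to the eigenvalue l of Lambda is
   [[t, - beta], [c, 0]] with t = mode_trace and c = mode_entry; its trace is t
   and its determinant beta * c. *)
Definition mode_trace {R : realType} (eta beta zeta l : R) : R :=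
  1 + beta - eta * (zeta + 1 - beta) * l.

Definition mode_entry {R : realType} (eta zeta l : R) : R := 1 - eta * zeta * l.

Definition noise_gain {R : realType} {d} (lam : 'rV[R]_d) (eta : R) (B : nat)
    (S : 'M[R]_(d + d)) : R :=
  eta ^+ 2 / B%:R * \tr (diag_mx lam *m ulsubmx S).

Lemma noise_gain_diag_block {R : realType} {d} (lam p q s : 'rV[R]_d) eta B :
  noise_gain lam eta B (diag_block p q s)
  = eta ^+ 2 / B%:R * \sum_j lam 0 j * p 0 j.
Proof.
rewrite /noise_gain block_mxKul mulmx_diag mxtrace_diag.
by congr (_ * _); apply: eq_bigr => j _; rewrite !mxE.
Qed.

Lemma diag_block_sym {R : realType} {d} (p q s : 'rV[R]_d) :
  diag_block p q s \in symmetric_space R (d + d).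
Proof. by rewrite mem_symmetric_space /diag_block tr_block_mx !tr_diag_mx. Qed.

(* Since x / 0 = 0, batch size 0 gives the noiseless map S |-> A S A^T. *)
Lemma asgd_map0_diag_block {R : realType} {d} (lam p q s : 'rV[R]_d)
    (eta beta zeta : R) :
  let t j := mode_trace eta beta zeta (lam 0 j) in
  let c j := mode_entry eta zeta (lam 0 j) in
  asgd_map lam eta beta zeta 0 (diag_block p q s)
  = diag_block
      (\row_j (t j ^+ 2 * p 0 j - 2 * t j * beta * q 0 j + beta ^+ 2 * s 0 j))
      (\row_j (c j * (t j * p 0 j - beta * q 0 j)))
      (\row_j (c j ^+ 2 * p 0 j)).
Proof.
move=> t c; rewrite /asgd_map invr0 mulr0 mul0r scale0r addr0.
have -> : asgd_matrix lam eta beta zeta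
    = block_mx (diag_mx (\row_j t j)) (diag_mx (const_mx (- beta)))
        (diag_mx (\row_j c j)) (diag_mx 0).
  rewrite /asgd_matrix !diag_const_mx raddf0; congr block_mx; apply/matrixP => i j.
  - rewrite !mxE /t /mode_trace; case: eqP => // _; rewrite ?mulr1n ?mulr0n; ring.
  - by rewrite !mxE mulNrn.
  - rewrite !mxE /c /mode_entry; case: eqP => // _; rewrite ?mulr1n ?mulr0n; ring.
rewrite /diag_block tr_block_mx !tr_diag_mx !mulmx_block !mulmx_diag.
rewrite -!raddfD /= !mulmx_diag -!raddfD /=.
by congr block_mx; congr diag_mx; apply/rowP => j; rewrite !mxE; ring.
Qed.

Lemma asgd_noise_diag_block {R : realType} {d} (lam : 'rV[R]_d) (beta zeta : R) :
  asgd_noise lam beta zeta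
  = diag_block ((zeta + 1 - beta) ^+ 2 *: lam)
      ((zeta * (zeta + 1 - beta)) *: lam) (zeta ^+ 2 *: lam).
Proof. by rewrite /diag_block !linearZ. Qed.

Definition sym_diag_block {R : realType} {d} (p q s : 'rV[R]_d) :
    subvs_of (symmetric_space R (d + d)) :=
  vsproj (symmetric_space R (d + d)) (diag_block p q s).

Lemma val_sym_diag_block {R : realType} {d} (p q s : 'rV[R]_d) :
  vsval (sym_diag_block p q s) = diag_block p q s.
Proof. by rewrite /sym_diag_block vsprojK ?diag_block_sym. Qed.

Lemma noise_gain_scalar {R : realType} {d} (lam : 'rV[R]_d) eta B :
  scalar (noise_gain lam eta B \o @vsval R _ (symmetric_space R (d + d))).
Proof.
move=> a U V; rewrite /comp linearP /noise_gain.
have -> : ulsubmx (a *: vsval U + vsval V)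
    = a *: ulsubmx (vsval U) + ulsubmx (vsval V).
  by apply/matrixP => i j; rewrite !mxE.
by rewrite mulmxDr -scalemxAr mxtraceD mxtraceZ; ring.
Qed.

Lemma asgd_op_rank_one {R : realType} {d} (lam : 'rV[R]_d) (eta beta zeta : R)
    (B : nat) (S : subvs_of (symmetric_space R (d + d))) :
  asgd_op lam eta beta zeta B S
  = asgd_op lam eta beta zeta 0 S
    + noise_gain lam eta B (vsval S)
        *: vsproj (symmetric_space R (d + d)) (asgd_noise lam beta zeta).
Proof.
apply: subvs_inj; rewrite linearD linearZ /= !asgd_opE vsprojK; last first.
  by rewrite asgd_noise_diag_block diag_block_sym.
by rewrite /asgd_map invr0 mulr0 mul0r scale0r addr0.
Qed.

(** The factor [k] allows two uses: k = 1 gives the resolvent applied to the noise, k = 0 the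
    eigenvector equation. *)
Lemma asgd_op0_resolvent {R : realType} {d} (lam p q s : 'rV[R]_d)
    (eta beta zeta z : R) :
  let t j := mode_trace eta beta zeta (lam 0 j) in
  let c j := mode_entry eta zeta (lam 0 j) in
  let th := zeta + 1 - beta in
  forall k : R,
  (forall j,
    [/\ z * p 0 j = t j ^+ 2 * p 0 j - 2 * t j * beta * q 0 j
                    + beta ^+ 2 * s 0 j + k * lam 0 j * th ^+ 2,
        z * q 0 j = c j * (t j * p 0 j - beta * q 0 j) + k * lam 0 j * (zeta * th)
      & z * s 0 j = c j ^+ 2 * p 0 j + k * lam 0 j * zeta ^+ 2]) ->
  z *: sym_diag_block p q s - asgd_op lam eta beta zeta 0 (sym_diag_block p q s)
  = k *: vsproj (symmetric_space R (d + d)) (asgd_noise lam beta zeta).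
Proof.
move=> t c th k H; apply: subvs_inj; rewrite linearB !linearZ /= asgd_opE.
rewrite vsprojK ?asgd_noise_diag_block ?diag_block_sym // val_sym_diag_block.
rewrite asgd_map0_diag_block -/t -/c; apply/eqP; rewrite subr_eq; apply/eqP.
rewrite /diag_block !scale_block_mx add_block_mx -!linearZ -!linearD /=.
by congr block_mx; congr diag_mx; apply/rowP => j; rewrite !mxE;
  have [h1 h2 h3] := H j; rewrite ?h1 ?h2 ?h3 /th /t /c; ring.
Qed.

(* mode_num / mode_den is the upper left entry of the solution S of
   z S - A S A^T = g g^T, where A = [[t, - beta], [c, 0]] and
   g = (zeta + 1 - beta, zeta). *)
Definition mode_den {R : realType} (beta t c z : R) : R :=
  (z - beta * c) * ((z + beta * c) ^+ 2 - t ^+ 2 * z).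

Definition mode_num {R : realType} (beta zeta t c z : R) : R :=
  let th := zeta + 1 - beta in
  (th ^+ 2 * z + beta ^+ 2 * zeta ^+ 2) * (z + beta * c)
  - 2 * th * beta * zeta * t * z.

(** With z = m^2 and U = z + beta c, the numerator is half the sum of the squares (th m - beta
    zeta)^2 and (th m + beta zeta)^2 weighted by U + t m and U - t m, and |t m| <= U. *)
Lemma mode_num_ge0 {R : realType} (beta zeta t c z : R) :
  0 < z -> 0 <= z + beta * c -> t ^+ 2 * z <= (z + beta * c) ^+ 2 ->
  0 <= mode_num beta zeta t c z.
Proof.
move=> z0 U0 tU; rewrite /mode_num /=.
set th := zeta + 1 - beta; set U := z + beta * c in U0 tU *.
have [m m0 zE] : exists2 m, 0 <= m & z = m ^+ 2.
  by exists (Num.sqrt z); rewrite ?sqrtr_ge0 // sqr_sqrtr // ltW.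
have tmU : `|t * m| <= U.
  by rewrite -(@ler_pXn2r _ 2) ?nnegrE ?normr_ge0 // real_normK ?num_real // exprMn -zE.
move: tmU; rewrite ler_norml => /andP[U1 U2].
have -> : (th ^+ 2 * z + beta ^+ 2 * zeta ^+ 2) * U - 2 * th * beta * zeta * t * z
  = ((th * m - beta * zeta) ^+ 2 * (U + t * m)
     + (th * m + beta * zeta) ^+ 2 * (U - t * m)) / 2 by rewrite zE; field.
rewrite divr_ge0 // addr_ge0 // mulr_ge0 ?sqr_ge0 //; lra.
Qed.

(** The last two equations give [s] and [q] in terms of [p]; substituting them into the first and
    multiplying by z (z + beta c) leaves den * p = k * num. *)
Lemma mode_solution {R : realType} (beta zeta t c z k : R) :
  let th := zeta + 1 - beta in
  let p := k * (mode_num beta zeta t c z / mode_den beta t c z) in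
  let q := (c * t * p + k * (zeta * th)) / (z + beta * c) in
  let s := (c ^+ 2 * p + k * zeta ^+ 2) / z in
  z != 0 -> z + beta * c != 0 -> mode_den beta t c z != 0 ->
  [/\ z * p = t ^+ 2 * p - 2 * t * beta * q + beta ^+ 2 * s + k * th ^+ 2,
      z * q = c * (t * p - beta * q) + k * (zeta * th)
    & z * s = c ^+ 2 * p + k * zeta ^+ 2].
Proof.
move=> th p q s z0 zd0; rewrite /mode_den mulf_eq0 negb_or => /andP[d1 d2].
rewrite /q /s /p /mode_num /mode_den /th /=; split; field; by rewrite ?z0 ?zd0 ?d1 ?d2.
Qed.

Lemma asgd_op0_root {R : realType} {d} (lam : 'rV[R]_d) (eta beta zeta z : R)
    (j : 'I_d) (p q s : R) :
  let t := mode_trace eta beta zeta (lam 0 j) in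
  let c := mode_entry eta zeta (lam 0 j) in
  p != 0 ->
  z * p = t ^+ 2 * p - 2 * t * beta * q + beta ^+ 2 * s ->
  z * q = c * (t * p - beta * q) ->
  z * s = c ^+ 2 * p ->
  root (lfun_char_poly (asgd_op lam eta beta zeta 0)) z.
Proof.
move=> t c p0 h1 h2 h3.
pose u (x : R) : 'rV[R]_d := \row_i (if i == j then x else 0).
apply: (root_lfun_char_poly _ z (sym_diag_block (u p) (u q) (u s))).
  apply: contra p0 => /eqP/(congr1 vsval); rewrite val_sym_diag_block linear0.
  by move/matrixP/(_ (lshift d j) (lshift d j)); rewrite block_mxEul !mxE !eqxx mulr1n => ->.
apply/eqP; rewrite eq_sym -subr_eq0; apply/eqP.
rewrite (@asgd_op0_resolvent _ _ _ _ _ _ _ _ _ _ 0) ?scale0r // => i.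
rewrite !mul0r !addr0 !mxE; case: eqP => [->|_]; first by split.
by rewrite !mulr0 !subr0 !mulr0 !addr0; split.
Qed.

(** If the mode has eigenvalues m1 and m2, its action on symmetric 2 by 2 matrices has eigenvalues
    m1 m2 = beta c, m1^2 and m2^2, and (z + beta c)^2 - t^2 z = (z - m1^2) (z - m2^2). A real one
    among them that is at least [r] would be a forbidden root. *)
Lemma mode_stable {R : realType} {d} (lam : 'rV[R]_d) (eta beta zeta r : R) :
  0 < r ->
  (forall z, r <= z -> ~~ root (lfun_char_poly (asgd_op lam eta beta zeta 0)) z) ->
  forall (j : 'I_d) z, r <= z ->
  let t := mode_trace eta beta zeta (lam 0 j) in
  let c := mode_entry eta zeta (lam 0 j) in
  [/\ beta * c < z, t ^+ 2 * z < (z + beta * c) ^+ 2 & 0 < z + beta * c].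
Proof.
move=> r0 nr j z rz t c.
have disc y : r <= y -> t ^+ 2 * y < (y + beta * c) ^+ 2.
  move=> ry; pose P := ('X - (- (beta * c))%:P) ^+ 2 - t ^+ 2 *: 'X.
  have PE x : P.[x] = (x + beta * c) ^+ 2 - t ^+ 2 * x by rewrite /P !hornerE opprK.
  have Pm : P \is monic.
    have mX := monic_exp 2 (monicXsubC (- (beta * c))).
    rewrite monicE lead_coefDl ?(monicP mX) // size_polyN.
    rewrite (leq_ltn_trans (size_scale_leq _ _)) // size_polyX.
    by rewrite size_exp_XsubC.
  rewrite -subr_gt0 -PE; apply: monic_gt0 => // x yx.
  have x0 : 0 < x by apply: lt_le_trans r0 (le_trans ry yx).
  apply: contra (nr x (le_trans ry yx)) => /eqP; rewrite PE => /eqP; rewrite subr_eq0.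
  have xE : x = Num.sqrt x ^+ 2 by rewrite sqr_sqrtr // ltW.
  rewrite {2}xE -exprMn eqf_sqr => h.
  have [m mE hm] : exists2 m, m ^+ 2 = x & x + beta * c = t * m.
    case/orP: h => /eqP h; first by exists (Num.sqrt x).
    by exists (- Num.sqrt x); rewrite ?sqrrN // mulrN.
  have hm' : beta * c = t * m - x by rewrite -hm addrC addKr.
  (* (m, c) is an eigenvector of the mode for its eigenvalue m. *)
  apply: (@asgd_op0_root _ _ _ _ _ _ _ j x (m * c) (c ^+ 2)); rewrite -/t -/c.
  - by rewrite gt_eqF.
  - rewrite [beta ^+ 2 * _](_ : _ = (beta * c) ^+ 2); last by ring.
    rewrite [2 * _ * _ * _](_ : _ = 2 * t * m * (beta * c)); last by ring.
    by rewrite hm' -mE; ring.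
  - rewrite [beta * _](_ : _ = m * (beta * c)); last by ring.
    by rewrite hm' -mE; ring.
  - by rewrite mulrC.
have bcz : beta * c < z.
  rewrite ltNge; apply/negP => zbc.
  have rbc := le_trans rz zbc.
  have bc0 : 0 < beta * c by apply: lt_le_trans r0 rbc.
  move/negP: (nr _ rbc); apply.
  (* The eigenvector for the determinant is (A - t / 2) J, with J the rotation
     by a quarter turn: A J A^T = det(A) J. *)
  apply: (@asgd_op0_root _ _ _ _ _ _ _ j beta (t / 2) c); rewrite -/t -/c.
  - by apply: contraTneq bc0 => ->; rewrite mul0r ltxx.
  - by field.
  - by field.
  - by ring.
split=> //; first exact: disc.
rewrite ltNge; apply/negP => neg.
(* At the positive point y = - beta c the square in [disc] vanishes, so [disc] would claim t^2 y <
   0. *)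
have ry : r <= - (beta * c) by lra.
have := disc _ ry; rewrite addNr expr0n /= ltNge mulr_ge0 ?sqr_ge0 //; lra.
Qed.

Lemma asgd_stable {R : realType} {d} (lam : 'rV[R]_d) (eta beta zeta r : R)
    (B : nat) :
  0 < r -> spectral_radius (asgd_op lam eta beta zeta B) < r ->
  forall z, r <= z ->
  let t j := mode_trace eta beta zeta (lam 0 j) in
  let c j := mode_entry eta zeta (lam 0 j) in
  (forall j, [/\ beta * c j < z, t j ^+ 2 * z < (z + beta * c j) ^+ 2
                & 0 < z + beta * c j]) /\
  eta ^+ 2 / B%:R * \sum_j lam 0 j ^+ 2
     * (mode_num beta zeta (t j) (c j) z / mode_den beta (t j) (c j) z) < 1.
Proof.
move=> r0 rho.
pose f := asgd_op lam eta beta zeta B; pose g := asgd_op lam eta beta zeta 0.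
pose N := vsproj (symmetric_space R (d + d)) (asgd_noise lam beta zeta).
pose phi0 := noise_gain lam eta B \o @vsval R _ (symmetric_space R (d + d)).
pose phi : {scalar _} := HB.pack_for {scalar _} phi0
  (GRing.isLinear.Build R _ _ _ phi0 (noise_gain_scalar lam eta B)).
have fE v : f v = g v + phi v *: N by exact: asgd_op_rank_one.
pose t j := mode_trace eta beta zeta (lam 0 j).
pose c j := mode_entry eta zeta (lam 0 j).
have fr z : r <= z -> ~~ root (lfun_char_poly f) z.
  move=> rz; apply/negP => /spectral_radius_ge; rewrite leNgt => /negP; apply.
  by rewrite gtr0_norm ?(lt_le_trans r0) // (lt_le_trans rho).
have sol z : r <= z -> (forall y, z <= y -> ~~ root (lfun_char_poly g) y) ->
    exists2 S, z *: S - g S = N & 0 <= phi S /\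
      phi S = eta ^+ 2 / B%:R * \sum_j lam 0 j ^+ 2
        * (mode_num beta zeta (t j) (c j) z / mode_den beta (t j) (c j) z).
  move=> rz gz; have z0 := lt_le_trans r0 rz.
  have st j := mode_stable lam eta beta zeta z z0 gz j z (lexx z).
  have den0 j : 0 < mode_den beta (t j) (c j) z.
    by have [h1 h2 h3] := st j; rewrite mulr_gt0 // subr_gt0.
  (* The noise on mode j is lam_j g g^T, so [mode_solution] is used with k = lam_j. *)
  pose p j := lam 0 j * (mode_num beta zeta (t j) (c j) z / mode_den beta (t j) (c j) z).
  pose th := zeta + 1 - beta.
  pose q j := (c j * t j * p j + lam 0 j * (zeta * th)) / (z + beta * c j).
  pose s j := (c j ^+ 2 * p j + lam 0 j * zeta ^+ 2) / z.
  exists (sym_diag_block (\row_j p j) (\row_j q j) (\row_j s j)).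
    rewrite (@asgd_op0_resolvent _ _ _ _ _ _ _ _ _ _ 1) ?scale1r // => j.
    rewrite !mxE !mul1r; apply: mode_solution; rewrite ?gt_eqF //.
    by have [] := st j.
  have -> : phi (sym_diag_block (\row_j p j) (\row_j q j) (\row_j s j))
      = eta ^+ 2 / B%:R * \sum_j lam 0 j ^+ 2
        * (mode_num beta zeta (t j) (c j) z / mode_den beta (t j) (c j) z).
    rewrite /= /phi0 /comp val_sym_diag_block noise_gain_diag_block.
    by congr (_ * _); apply: eq_bigr => j _; rewrite mxE /p mulrA expr2.
  split=> //; rewrite mulr_ge0 ?divr_ge0 ?sqr_ge0 // sumr_ge0 // => j _.
  rewrite mulr_ge0 ?sqr_ge0 // divr_ge0 ?(ltW (den0 j)) //.
  by have [_ h2 h3] := st j; rewrite mode_num_ge0 // ltW.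
have gr z : r <= z -> ~~ root (lfun_char_poly g) z.
  move: z; apply: (rank_one_no_large_root f g phi N r fE fr) => z rz gz.
  by have [S SE [S0 _]] := sol z rz gz; exists S.
move=> z rz; split.
  by move=> j; have [] := mode_stable lam eta beta zeta r r0 gr j z rz.
have gz y : z <= y -> ~~ root (lfun_char_poly g) y.
  by move=> zy; apply: gr; apply: le_trans zy.
have fz y : z <= y -> ~~ root (lfun_char_poly f) y.
  by move=> zy; apply: fr; apply: le_trans zy.
have [S SE [_ <-]] := sol z rz gz.
exact: (rank_one_functional_lt1 f g phi N S z fE fz gz SE).
Qed.

(** * Estimates for a single mode *)

(** The first two bounds are read off 1 + beta c + t > 0. For the third, 1 + beta c - t = om X (1 +
    zeta) cancels against the numerator and leaves X E / ((1 - de) (1 + de + t)), where E >= om / 2,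
    1 - de <= om + Z and 1 + de + t <= 4. *)
Lemma mode_bounds_at1 {R : realType} (eta beta zeta l : R) :
  let t := mode_trace eta beta zeta l in
  let c := mode_entry eta zeta l in
  let om := 1 - beta in
  0 < eta -> 0 <= beta < 1 -> 0 < zeta -> 0 < l ->
  beta * c < 1 -> t ^+ 2 < (1 + beta * c) ^+ 2 -> 0 < 1 + beta * c ->
  [/\ eta * zeta * l < 2, eta * om * l < 4
    & eta * l * om / (8 * (om + eta * zeta * l))
      <= eta ^+ 2 * (l ^+ 2 * (mode_num beta zeta t c 1 / mode_den beta t c 1))].
Proof.
move=> t c om eta0 /andP[b0 b1] z0 l0 dl1 td d0.
have om0 : 0 < om by rewrite /om; lra.
have om1 : om <= 1 by rewrite /om; lra.
set X := eta * l; have X0 : 0 < X by rewrite mulr_gt0.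
have tE : t = 1 + beta - X * (zeta + om) by rewrite /t /mode_trace /X /om; ring.
have cE : c = 1 - zeta * X by rewrite /c /mode_entry /X; ring.
set de := beta * c in dl1 td d0 *.
have deE : de = beta - beta * (zeta * X) by rewrite /de cE; ring.
set Z := zeta * X in deE; have Z0 : 0 < Z by rewrite mulr_gt0.
have bZ0 : 0 <= beta * Z by rewrite mulr_ge0 // ltW.
have omX : 0 < om * X by rewrite mulr_gt0.
have hp : 0 < 1 + de + t.
  have : `|t| < 1 + de.
    by rewrite -(@ltr_pXn2r _ 2) ?nnegrE ?normr_ge0 ?(ltW d0) // real_normK ?num_real.
  by rewrite ltr_norml; lra.
have hpE : 1 + de + t = 2 + 2 * beta - Z * (1 + beta) - om * X.
  by rewrite deE tE /Z; ring.
have Z2 : Z < 2 by rewrite -(@ltr_pM2r _ (1 + beta)); lra.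
have omX4 : om * X < 4.
  by have : 0 < Z * (1 + beta); [rewrite mulr_gt0 //|]; lra.
have ZE : eta * zeta * l = Z by rewrite /Z /X; ring.
split; [by rewrite ZE | by rewrite (_ : eta * om * l = om * X) // /X; ring |].
rewrite ZE; set P := om * X * (1 + zeta).
have P0 : 0 < P by rewrite mulr_gt0 //; lra.
have hm : 1 + de - t = P by rewrite deE tE /P /Z /om; ring.
set E := om * (1 + zeta) * (1 + de) + 2 * beta * Z * (zeta + om).
have numE : mode_num beta zeta t c 1 = om * (1 + zeta) * E.
  by rewrite /mode_num /= -/de /E tE /de cE /Z /om; ring.
have denE : mode_den beta t c 1 = (1 - de) * P * (1 + de + t).
  by rewrite /mode_den -/de -hm; ring.
(* For de >= -1/2 the first summand of [E] suffices. Otherwise beta (Z - 1) > 1/2 with Z < 2, so Z >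
   1 and beta > 1/2, and the second summand is at least om. *)
have E0 : om / 2 <= E.
  have E2 : 0 <= 2 * beta * Z * (zeta + om).
    by rewrite !mulr_ge0 ?(ltW Z0) // ltW // addr_gt0.
  have oz0 : 0 <= om * zeta by rewrite mulr_ge0 // ltW.
  have [h|h] := leP (- (1 / 2)) de.
    have : om * (1 / 2) <= om * (1 + zeta) * (1 + de).
      by rewrite -mulrA ler_pM2l // -[leLHS]mul1r ler_pM //; lra.
    by rewrite /E; lra.
  have Z1 : 1 < Z.
    rewrite ltNge; apply/negP => Zle; have : beta * Z <= beta * 1 by rewrite ler_wpM2l.
    by lra.
  have bh : 1 / 2 < beta.
    rewrite ltNge; apply/negP => ble.
    have : beta * (Z - 1) <= 1 / 2 * (Z - 1) by rewrite ler_wpM2r //; lra.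
    by lra.
  have h1 : om <= 2 * beta * Z * (zeta + om).
    have h0 : 1 * 1 <= 2 * beta * Z by apply: ler_pM; lra.
    have : 1 * om <= 2 * beta * Z * (zeta + om) by apply: ler_pM; lra.
    by lra.
  have h2 : 0 <= om * (1 + zeta) * (1 + de).
    by rewrite !mulr_ge0 ?(ltW om0) ?(ltW d0) // ltW // addr_gt0.
  by rewrite /E; lra.
have dl : 0 < 1 - de by lra.
have den0 : 0 < (1 - de) * (1 + de + t) by rewrite mulr_gt0.
have z1 : 1 + zeta != 0 by rewrite gt_eqF //; lra.
rewrite numE denE.
have -> : eta ^+ 2 * (l ^+ 2 * (om * (1 + zeta) * E / ((1 - de) * P * (1 + de + t))))
    = X * E / ((1 - de) * (1 + de + t)).
  rewrite /P /X; field.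
  by rewrite z1 !gt_eqF //=; rewrite /om; lra.
have oZ0 : 0 < om + Z by lra.
rewrite ler_pdivrMr ?mulr_gt0 // [leRHS]mulrAC ler_pdivlMr //.
have h1 : (1 - de) * (1 + de + t) <= (om + Z) * 4.
  rewrite ler_pM ?(ltW hp) ?(ltW dl) //; last by rewrite hpE; lra.
  have : beta * Z <= 1 * Z by rewrite ler_wpM2r // ltW.
  by rewrite deE /om; lra.
have -> : X * E * (8 * (om + Z)) = 2 * E * X * ((om + Z) * 4) by ring.
have h2 : X * om <= X * (2 * E) by rewrite ler_pM2l //; lra.
apply: ler_pM => //; [by rewrite mulr_ge0 ?(ltW X0) ?(ltW om0) | exact: ltW |].
by rewrite [2 * E * X]mulrC.
Qed.

(** The first bound is beta c < 1 - e. The second says that the characteristic polynomial x^2 - t x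
    + beta c of the mode is positive slightly below 1, expanded in e. *)
Lemma mode_gap {R : realType} (eta beta zeta l e : R) :
  let t := mode_trace eta beta zeta l in
  let c := mode_entry eta zeta l in
  let om := 1 - beta in
  0 < eta -> 0 <= beta < 1 -> 0 < zeta -> 0 < l -> 0 < e < 1 ->
  (forall z, 1 - e <= z -> [/\ beta * c < z,
     t ^+ 2 * z < (z + beta * c) ^+ 2 & 0 < z + beta * c]) ->
  e < om + eta * zeta * l /\
  e * (om + eta * zeta * l) <= 4 * (eta * l * om * (1 + zeta)).
Proof.
move=> t c om eta0 /andP[b0 b1] z0 l0 /andP[e0 e1] H.
have om0 : 0 < om by rewrite /om; lra.
set X := eta * l; have X0 : 0 < X by rewrite mulr_gt0.
have tE : t = 1 + beta - X * (zeta + om) by rewrite /t /mode_trace /X /om; ring.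
have cE : c = 1 - zeta * X by rewrite /c /mode_entry /X; ring.
set Z := zeta * X in cE; have Z0 : 0 < Z by rewrite mulr_gt0.
have ZE : eta * zeta * l = Z by rewrite /Z /X; ring.
have bZ : beta * Z <= 1 * Z by rewrite ler_wpM2r // ltW.
have eom : e < om + Z.
  by have [h _ _] := H _ (lexx _); move: h; rewrite cE mulrBr mulr1 /om; lra.
rewrite ZE; split=> //.
pose x := 1 - e / 2; have x0 : 0 < x by rewrite /x; lra.
have rx : 1 - e <= x ^+ 2.
  rewrite (_ : x ^+ 2 = 1 - e + e ^+ 2 / 4); last by rewrite /x; field.
  by rewrite lerDl divr_ge0 ?sqr_ge0.
have [_ h1 h2] := H _ rx.
have tx : t * x < x ^+ 2 + beta * c.
  apply: le_lt_trans (ler_norm _) _.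
  by rewrite -(@ltr_pXn2r _ 2) ?nnegrE ?normr_ge0 ?(ltW h2) // real_normK ?num_real // exprMn.
set q := om + Z + om * X; set p := X * om * (1 + zeta).
have omX0 : 0 < om * X by rewrite mulr_gt0.
have : 0 < e ^+ 2 / 4 - q * e / 2 + p.
  suff -> : e ^+ 2 / 4 - q * e / 2 + p = x ^+ 2 + beta * c - t * x by lra.
  by rewrite /q /p /x tE cE /Z /om; field.
have : e * e <= e * q by rewrite ler_pM2l // /q; lra.
have : 0 <= e * (om * X) by rewrite mulr_ge0 // ltW.
rewrite /q expr2; lra.
Qed.

(** Here [l1] and [ld] stand for the largest and smallest eigenvalues. Stability at [l1] gives eta
    zeta ld <= 2 X and eta om ld <= 4 X. As 16 X <= e, the terms in eta zeta ld are absorbed by e,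
    leaving e <= 2 om and e <= 8 eta ld, whose products give the rest. *)
Lemma two_mode_bounds {R : realType} (eta om zeta l1 ld e X : R) :
  0 < eta -> 0 < om -> 0 < zeta -> 0 < l1 -> 0 < ld ->
  eta * zeta * l1 < 2 -> eta * om * l1 < 4 -> ld <= X * l1 -> 16 * X <= e ->
  e < om + eta * zeta * ld ->
  e * (om + eta * zeta * ld) <= 4 * (eta * ld * om * (1 + zeta)) ->
  [/\ e <= 8 * (eta * ld), zeta * e ^+ 2 <= 32 * X * om & e ^+ 2 <= 64 * X].
Proof.
move=> eta0 om0 z0 l10 ld0 h1 h2 ldX Xe e1 e2.
have X0 : 0 < X by rewrite -(pmulr_lgt0 _ l10); apply: lt_le_trans ldX.
have e0 : 0 < e by lra.
have g1 : eta * zeta * ld <= 2 * X.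
  have k1 : eta * zeta * ld <= eta * zeta * (X * l1).
    by rewrite ler_pM2l // mulr_gt0.
  have k2 : X * (eta * zeta * l1) <= X * 2 by rewrite ler_pM2l // ltW.
  by lra.
have g2 : eta * om * ld <= 4 * X.
  have k1 : eta * om * ld <= eta * om * (X * l1).
    by rewrite ler_pM2l // mulr_gt0.
  have k2 : X * (eta * om * l1) <= X * 4 by rewrite ler_pM2l // ltW.
  by lra.
have eom : e <= 2 * om by lra.
have e8 : e <= 8 * (eta * ld).
  have k1 : om * (eta * zeta * ld) <= om * (2 * X) by rewrite ler_pM2l // ltW.
  have k2 : om * (16 * X) <= om * e by rewrite ler_pM2l // ltW.
  have k3 : 0 <= e * (eta * zeta * ld) by rewrite !mulr_ge0 // ltW.
  rewrite -(ler_pM2l om0); lra.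
have k0 : 0 <= eta * ld by rewrite mulr_ge0 // ltW.
split=> //.
  have k1 : zeta * e <= 16 * X.
    have : zeta * e <= zeta * (8 * (eta * ld)) by rewrite ler_pM2l.
    by lra.
  have k2 : zeta * e * e <= 16 * X * (2 * om) by rewrite ler_pM // ?mulr_ge0 // ltW.
  by rewrite expr2; lra.
have : e * e <= 2 * om * (8 * (eta * ld)) by rewrite ler_pM // ltW.
by rewrite expr2; lra.
Qed.

(** Used with l = lam_m and Y = m^a. After multiplication by e^2, the om part of om + eta zeta l
    contributes 64 X B and the zeta part 256 X B, which makes 320. *)
Lemma noise_bound {R : realType} (eta om zeta l ld e X Y m B : R) :
  0 < eta -> 0 < om -> 0 < zeta -> 0 < l -> 0 < ld -> 0 < e -> 0 < B ->
  0 < X -> 0 < Y ->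
  m * (eta * l * om / (8 * (om + eta * zeta * l))) <= B ->
  e <= 8 * (eta * ld) -> zeta * e ^+ 2 <= 32 * X * om ->
  ld <= X * Y * l -> Y * e <= 1 ->
  m * e ^+ 2 <= 320 * X * B.
Proof.
move=> eta0 om0 z0 l0 ld0 e0 B0 X0 Y0 hm e8 ze ldl Ye.
have s0 : 0 < om + eta * zeta * l by rewrite addr_gt0 // !mulr_gt0.
have W0 : 0 < eta * l * om by rewrite !mulr_gt0.
have hm' : m * (eta * l * om) <= 8 * B * (om + eta * zeta * l).
  move: hm; rewrite mulrA ler_pdivrMr ?mulr_gt0 //; lra.
rewrite -(ler_pM2r W0).
have k1 : m * e ^+ 2 * (eta * l * om) <= e ^+ 2 * (8 * B * (om + eta * zeta * l)).
  have -> : m * e ^+ 2 * (eta * l * om) = e ^+ 2 * (m * (eta * l * om)) by ring.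
  by rewrite ler_wpM2l ?sqr_ge0.
apply: le_trans k1 _.
have k2 : e ^+ 2 <= 8 * X * (eta * l).
  have a1 : e * e <= e * (8 * (eta * (X * Y * l))).
    rewrite ler_pM2l //; apply: le_trans e8 _.
    by rewrite ler_pM2l // ler_pM2l.
  have a2 : (8 * X * (eta * l)) * (Y * e) <= (8 * X * (eta * l)) * 1.
    by rewrite ler_wpM2l // !mulr_ge0 // ltW.
  by rewrite expr2; lra.
have k3 : 8 * B * om * e ^+ 2 <= 8 * B * om * (8 * X * (eta * l)).
  by rewrite ler_wpM2l // !mulr_ge0 // ltW.
have k4 : 8 * B * (eta * l) * (zeta * e ^+ 2) <= 8 * B * (eta * l) * (32 * X * om).
  by rewrite ler_wpM2l // !mulr_ge0 // ltW.
lra.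
Qed.

(** * Bounds on the spectral gap *)

(** Two decreasing lists of roots of the same split polynomial are permutations of each other, hence
    equal. *)
Lemma spectrumE {R : realType} {d} (H : 'M[R]_d) (lam : 'rV[R]_d) :
  ordered_eigenvalues H lam -> spectrum H = lam.
Proof.
move=> Hlam; apply: xget_unique => // mu [Hmu mu_dec].
case: Hlam => Hl lam_dec.
pose s (v : 'rV[R]_d) : seq R := [seq v 0 i | i <- enum 'I_d].
have sP (v : 'rV[R]_d) : \prod_(i < d) ('X - (v 0 i)%:P) = \prod_(x <- s v) ('X - x%:P).
  by rewrite big_map big_enum.
have srt (v : 'rV[R]_d) :
    (forall i j : 'I_d, (i <= j)%N -> v 0 j <= v 0 i) ->
    sorted >=%O (s v).
  move=> dec; rewrite sorted_map.
  have : sorted ltn (map val (enum 'I_d)) by rewrite val_enum_ord iota_ltn_sorted.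
  rewrite sorted_map; apply: sub_sorted => i j /= ij.
  by apply: dec; apply: ltnW.
have : perm_eq (s mu) (s lam) by apply: prod_XsubC_eq; rewrite -!sP -Hl -Hmu.
move=> /(sorted_eq ge_trans ge_anti (srt _ mu_dec) (srt _ lam_dec)) E.
apply/rowP => i; have := congr1 (fun l => nth 0 l i) E; rewrite /s.
by rewrite !(nth_map i) -?enumT ?size_enum_ord // nth_ord_enum.
Qed.

Lemma asgd_gap_bounds {R : realType} (a c1 c2 : R) (d : nat) (lam : 'rV[R]_d)
    (eta beta zeta e : R) (B : nat) :
  let X := c2 / c1 * d%:R `^ (- a) in
  1 < a -> 0 < c1 -> c1 <= c2 -> (0 < d)%N -> (0 < B)%N ->
  (forall i j : 'I_d, (i <= j)%N -> lam 0 j <= lam 0 i) ->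
  (forall i : 'I_d,
     c1 * (i.+1)%:R `^ (- a) <= lam 0 i <= c2 * (i.+1)%:R `^ (- a)) ->
  0 < eta -> 0 <= beta < 1 -> 0 < zeta -> 0 < e < 1 ->
  spectral_radius (asgd_op lam eta beta zeta B) < 1 - e ->
  16 * X <= e ->
  e ^+ 2 <= 64 * X /\ e `^ (2 - a^-1) <= 640 * X * B%:R.
Proof.
move=> X a1 c10 c12 d0 B0 dec bnd eta0 b01 z0 /andP[e0 e1] rho Xe.
have [b0 b1] := andP b01.
have c20 : 0 < c2 by apply: lt_le_trans c12.
have a0 : 0 < a by lra.
have lam0 j : 0 < lam 0 j.
  by have /andP[h _] := bnd j; apply: lt_le_trans h; rewrite mulr_gt0 // powR_gt0.
have dR : 0 < d%:R :> R by rewrite ltr0n.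
have X0 : 0 < X by rewrite mulr_gt0 ?divr_gt0 ?powR_gt0.
have st := asgd_stable lam eta beta zeta (1 - e) B ltac:(lra) rho.
set t := fun j => mode_trace eta beta zeta (lam 0 j) in st.
set c := fun j => mode_entry eta zeta (lam 0 j) in st.
have [st1 noise] := st 1 ltac:(lra).
set om := 1 - beta; have om0 : 0 < om by rewrite /om; lra.
pose u l := eta * l * om / (8 * (om + eta * zeta * l)).
have at1 j : [/\ eta * zeta * lam 0 j < 2, eta * om * lam 0 j < 4
    & u (lam 0 j) <= eta ^+ 2 * (lam 0 j ^+ 2
        * (mode_num beta zeta (t j) (c j) 1 / mode_den beta (t j) (c j) 1))].
  have [h1 h2 h3] := st1 j; apply: mode_bounds_at1 => //.
  by move: h2; rewrite mulr1.
(* Indices are 0-based: [i1] is the largest mode, and [id], of value d - 1, is the smallest. *)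
pose i1 := Ordinal d0; have dpred : (d.-1 < d)%N by rewrite prednK.
pose id := Ordinal dpred.
have [g1 g2 _] := at1 i1.
have [gap1 gap2] : e < om + eta * zeta * lam 0 id /\
    e * (om + eta * zeta * lam 0 id) <= 4 * (eta * lam 0 id * om * (1 + zeta)).
  apply: mode_gap => //; first by rewrite e0.
  by move=> z rz; have [h _] := st z rz; apply: h.
have ldub : lam 0 id <= c2 * d%:R `^ (- a).
  by have /andP[_] := bnd id; rewrite /= prednK.
have ldX : lam 0 id <= X * lam 0 i1.
  apply: le_trans ldub _.
  have /andP[h _] := bnd i1; rewrite powR1 mulr1 in h.
  rewrite (_ : c2 * _ = X * c1); last by rewrite /X; field; rewrite gt_eqF.
  by rewrite ler_pM2l.
have [e8 ze e64] := two_mode_bounds eta om zeta (lam 0 i1) (lam 0 id) e X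
  eta0 om0 z0 (lam0 _) (lam0 _) g1 g2 ldX Xe gap1 gap2.
split=> //.
set y := e `^ a^-1; have y0 : 0 < y by exact: powR_gt0.
have ya : y `^ a = e by rewrite /y -powRrM mulVf ?gt_eqF // powRr1 // ltW.
have y1 : y <= 1.
  by rewrite -(powRr0 e) ger_powR ?e0 ?ltW // invr_gt0.
(* This follows from d^(-a) <= X <= e and ensures that the cutoff m <= 1 / y chosen below does not
   exceed d. *)
have dy : d%:R^-1 <= y.
  have -> : d%:R^-1 = (d%:R `^ (- a)) `^ a^-1 :> R.
    by rewrite -powRrM mulNr divff ?gt_eqF // powR_inv1.
  rewrite ge0_ler_powR ?nnegrE ?powR_ge0 ?invr_ge0 ?ltW //.
  have : 1 <= c2 / c1 by rewrite ler_pdivlMr // mul1r.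
  have dp : 0 < d%:R `^ (- a) by exact: powR_gt0.
  rewrite -(ler_pM2r dp) mul1r -/X; lra.
(* m ~ e^(-1/a) balances the two terms of 1 / (eta lam_m) + zeta / om, which
   are at most of order m^a d^(-a) / e and d^(-a) / e^2. *)
pose m := Num.truncn y^-1.
have /andP[my ym] : m%:R <= y^-1 < m.+1%:R by rewrite truncn_itv // invr_ge0 ltW.
have m0 : (0 < m)%N.
  by rewrite /m truncn_gt0 -invr1 lef_pV2 ?posrE.
have md : (m <= d)%N.
  rewrite -(ler_nat R); apply: le_trans my _.
  by rewrite -[leRHS]invrK lef_pV2 ?posrE ?invr_gt0.
have mpred : (m.-1 < d)%N by rewrite prednK.
pose im := Ordinal mpred.
have mR : 0 < m%:R :> R by rewrite ltr0n.
have Y0 : 0 < m%:R `^ a :> R by exact: powR_gt0.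
have Ye : m%:R `^ a * e <= 1.
  rewrite -ya -powRM ?(ltW mR) ?(ltW y0) // -[leRHS](_ : 1 `^ a = 1); last by rewrite powR1.
  rewrite ge0_ler_powR ?nnegrE ?(ltW a0) ?mulr_ge0 ?(ltW mR) ?(ltW y0) //.
  by rewrite -ler_pdivlMr // div1r.
have ldl : lam 0 id <= X * m%:R `^ a * lam 0 im.
  apply: le_trans ldub _.
  rewrite (_ : c2 * _ = X * c1); last by rewrite /X; field; rewrite gt_eqF.
  rewrite -mulrA ler_pM2l //.
  have /andP[h _] := bnd im; rewrite /= prednK // powRN in h.
  by rewrite mulrC -ler_pdivrMr.
have B0' : 0 < B%:R :> R by rewrite ltr0n.
(* [u] is increasing, so each of the m largest modes contributes at least u(lam_m) to the gain; the
   other modes contribute nonnegatively. *)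
have us : m%:R * u (lam 0 im) <= B%:R.
  have den l : 0 < l -> 0 < om + eta * zeta * l by move=> l0; rewrite addr_gt0 ?mulr_gt0.
  have u0 l : 0 < l -> 0 <= u l.
    by move=> l0; rewrite divr_ge0 // ltW // !mulr_gt0 ?den.
  have umono l l' : 0 < l -> l <= l' -> u l <= u l'.
    move=> l0 ll'; have l'0 := lt_le_trans l0 ll'.
    rewrite /u ler_pdivrMr ?mulr_gt0 ?den // [leRHS]mulrAC ler_pdivlMr ?mulr_gt0 ?den //.
    have -> : eta * l * om * (8 * (om + eta * zeta * l'))
      = 8 * eta * om * om * l + 8 * eta * om * eta * zeta * l * l' by ring.
    have -> : eta * l' * om * (8 * (om + eta * zeta * l))
      = 8 * eta * om * om * l' + 8 * eta * om * eta * zeta * l * l' by ring.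
    by rewrite lerD2r ler_pM2l // !mulr_gt0.
  have -> : m%:R * u (lam 0 im) = \sum_(j < d | (j < m)%N) u (lam 0 im).
    rewrite -(big_ord_widen d (fun=> u (lam 0 im)) md) sumr_const card_ord.
    by rewrite mulr_natl.
  apply: le_trans (_ : \sum_(j < d) u (lam 0 j) <= _).
    rewrite [leRHS](bigID (fun j : 'I_d => (j < m)%N)) /= -[leLHS]addr0.
    apply: lerD; last by apply: sumr_ge0 => j _; apply: u0.
    apply: ler_sum => j jm; apply: umono => //; apply: dec => /=.
    by rewrite -ltnS prednK.
  move: noise; rewrite mulrAC ltr_pdivrMr // mul1r => /ltW; apply: le_trans.
  by rewrite mulr_sumr; apply: ler_sum => j _; have [] := at1 j.
have := noise_bound eta om zeta (lam 0 im) (lam 0 id) e X (m%:R `^ a) m%:R B%:R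
  eta0 om0 z0 (lam0 _) (lam0 _) e0 B0' X0 Y0 us e8 ze ldl Ye.
rewrite powRB; last by apply/implyP => _; rewrite gt_eqF.
rewrite (powR_mulrn 2) ?(ltW e0) // -/y => h.
(* Truncation loses at most a factor 2, which turns 320 into 640. *)
have m2 : y^-1 <= 2 * m%:R.
  have m1 : 1 <= m%:R :> R by rewrite ler1n.
  by move: ym; rewrite -natr1; lra.
have : e ^+ 2 * y^-1 <= e ^+ 2 * (2 * m%:R) by rewrite ler_pM2l // exprn_gt0.
lra.
Qed.

Lemma le_asgd_opt_radius {R : realType} {d} (H : 'M[R]_d) (B : nat) (x : R) :
  (forall eta beta zeta, 0 < eta -> 0 <= beta < 1 -> 0 < zeta ->
     x <= asgd_radius H eta beta zeta B) -> x <= asgd_opt_radius H B.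
Proof.
move=> h; apply: lb_le_inf.
  (* Any admissible triple shows that the infimum is over a nonempty set. *)
  exists (asgd_radius H 1 0 1 B); exists 1, 0, 1.
  by split; rewrite ?lexx ?ltr01.
by move=> _ [eta [beta [zeta [h1 h2 h3 ->]]]]; apply: h.
Qed.

(** Only ratios matter: f / g = x and f' / g' = x^k, so the constant M becomes M^k. *)
Lemma same_order_powR {R : realType} (f g f' g' x : nat -> R) (k : R) :
  0 < k ->
  (forall d, (0 < d)%N -> [/\ 0 < g d, 0 < g' d & 0 < x d]) ->
  (forall d, (0 < d)%N -> f d = g d * x d) ->
  (forall d, (0 < d)%N -> f' d = g' d * x d `^ k) ->
  same_order f g -> same_order f' g'.
Proof.
move=> k0 pos fE f'E [M M0 h]; exists (M `^ k); first exact: powR_gt0.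
move=> d d0; have [g0 g'0 x0] := pos d d0.
have := h d d0; rewrite fE // f'E // [M^-1 * _]mulrC [M * _]mulrC !ler_pM2l //.
move=> /andP[h1 h2]; rewrite [_^-1 * _]mulrC [_ `^ k * g' d]mulrC !ler_pM2l //.
have -> : (M `^ k)^-1 = M^-1 `^ k.
  by rewrite -powR_inv1 ?powR_ge0 // -powRrM mulrC powRrM powR_inv1 // ltW.
by rewrite !ge0_ler_powR ?nnegrE ?invr_ge0 ?(ltW k0) ?(ltW M0) ?(ltW x0).
Qed.

(** With x = B / d^(1/2) and k = a / (2a - 1), the ratio of the two gap bounds is x^k, because k/2 -
    a^2 / (2a - 1) = - a/2. The two directions use the exponents 1/k and k. *)
Lemma same_order_critical_batch {R : realType} (a C : R) (B : nat -> nat) :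
  1 < a -> 0 < C -> (forall d : nat, (1 <= B d)%N) ->
  same_order
    (fun d => C * (B d)%:R `^ (a / (2 * a - 1))
                * d%:R `^ (- (a ^+ 2 / (2 * a - 1))))
    (fun d => C * d%:R `^ (- (a / 2)))
  <-> same_order (fun d => (B d)%:R) (fun d => d%:R `^ (2^-1) : R).
Proof.
move=> a1 C0 B1; set k := a / (2 * a - 1).
have a2 : 0 < 2 * a - 1 by lra.
have k0 : 0 < k by rewrite divr_gt0 //; lra.
pose x d : R := (B d)%:R / d%:R `^ (2^-1).
have gd d : (0 < d)%N -> 0 < d%:R `^ (2^-1) :> R by move=> d0; rewrite powR_gt0 ?ltr0n.
have Bd d : 0 < (B d)%:R :> R by rewrite ltr0n.
have x0 d : (0 < d)%N -> 0 < x d by move=> d0; rewrite divr_gt0 ?gd.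
have Cd d : (0 < d)%N -> 0 < C * d%:R `^ (- (a / 2)).
  by move=> d0; rewrite mulr_gt0 // powR_gt0 ?ltr0n.
have BE d : (0 < d)%N -> (B d)%:R = d%:R `^ (2^-1) * x d.
  by move=> d0; rewrite mulrC divfK // gt_eqF ?gd.
have fE d : (0 < d)%N ->
    C * (B d)%:R `^ k * d%:R `^ (- (a ^+ 2 / (2 * a - 1)))
    = C * d%:R `^ (- (a / 2)) * x d `^ k.
  move=> d0; have dn0 : d%:R != 0 :> R by rewrite pnatr_eq0 -lt0n.
  rewrite BE // powRM ?powR_ge0 ?(ltW (x0 _ _)) // -powRrM.
  rewrite [_ * x d `^ k]mulrC mulrA -[LHS]mulrA -powRD ?dn0 ?implybT //.
  rewrite (_ : 2^-1 * k + _ = - (a / 2)); first by ring.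
  by rewrite /k; field; rewrite gt_eqF.
split.
  apply: (@same_order_powR _ _ _ _ _ (fun d => x d `^ k) k^-1).
  - by rewrite invr_gt0.
  - by move=> d d0; rewrite Cd // gd // powR_gt0 // x0.
  - exact: fE.
  - by move=> d d0; rewrite -powRrM divff ?gt_eqF // powRr1 ?(ltW (x0 _ _)) // BE.
apply: (@same_order_powR _ _ _ _ _ x k) => //.
by move=> d d0; rewrite Cd // gd // x0.
Qed.

Theorem theorem2 (R : realType) (a c1 c2 K : R)
    (a_gt1 : 1 < a) (c1_gt0 : 0 < c1) (c1_le_c2 : c1 <= c2) (K_ge1 : 1 <= K) :
  exists2 C : R, 0 < C &
    (forall (d : nat) (H : 'M[R]_d) (lam : 'rV[R]_d) (B : nat),
       (1 <= d)%N -> posdef H -> ordered_eigenvalues H lam ->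
       (forall i : 'I_d,
          c1 * (i.+1)%:R `^ (- a) <= lam 0 i <= c2 * (i.+1)%:R `^ (- a)) ->
       (1 <= B)%N ->
       [/\ B%:R <= K ->
             1 - C * B%:R * d%:R `^ (- (a ^+ 2 / (2 * a - 1)))
               <= asgd_opt_radius H B,
           K^-1 <= B%:R <= K * d%:R `^ (2^-1) ->
             1 - C * B%:R `^ (a / (2 * a - 1))
                   * d%:R `^ (- (a ^+ 2 / (2 * a - 1)))
               <= asgd_opt_radius H B
         & K^-1 * d%:R `^ (2^-1) <= B%:R ->
             1 - C * d%:R `^ (- (a / 2)) <= asgd_opt_radius H B])
    /\
    (forall B : nat -> nat, (forall d : nat, (1 <= B d)%N) ->
       same_order
         (fun d => C * (B d)%:R `^ (a / (2 * a - 1))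
                     * d%:R `^ (- (a ^+ 2 / (2 * a - 1))))
         (fun d => C * d%:R `^ (- (a / 2)))
       <-> same_order (fun d => (B d)%:R) (fun d => d%:R `^ (2^-1) : R)).
Proof.
set L := c2 / c1.
have L1 : 1 <= L by rewrite ler_pdivlMr // mul1r.
(* 641 is chosen to exceed strictly the constants 640 and 64 of [asgd_gap_bounds], and it covers the
   threshold 16; the existential hides the value from later rewriting. *)
have [C CE] : exists C, C = 641 * L by exists (641 * L).
have C1 : 1 <= C by rewrite CE; lra.
have C0 : 0 < C by lra.
exists C => //; split; last first.
  by move=> B B1; apply: same_order_critical_batch.
move=> d H lam B d1 _ Hlam bnd B1.
have a2 : 0 < 2 * a - 1 by lra.
have a0 : 0 < a by lra.
have dR : 1 <= d%:R :> R by rewrite ler1n.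
have dR0 : 0 < d%:R :> R by lra.
have BR : 1 <= B%:R :> R by rewrite ler1n.
set k := a / (2 * a - 1).
have k0 : 0 < k by rewrite divr_gt0.
have k1 : k <= 1 by rewrite ler_pdivrMr //; lra.
set X := L * d%:R `^ (- a).
(* It suffices to contradict one of the two gap bounds for a candidate gap e of size at least C
   d^(-a). *)
have gap e : d%:R `^ (- a) * C <= e ->
    (0 < e < 1 -> e ^+ 2 <= 64 * X -> e `^ (2 - a^-1) <= 640 * X * B%:R -> False) ->
    1 - e <= asgd_opt_radius H B.
  move=> de He; apply: le_asgd_opt_radius => eta beta zeta eta0 b01 z0.
  rewrite /asgd_radius (spectrumE _ _ Hlam).
  rewrite leNgt; apply/negP => rho.
  have e0 : 0 < e by apply: lt_le_trans de; rewrite mulr_gt0 ?powR_gt0.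
  (* A radius below 1 - e is still nonnegative, so candidates e >= 1 are excluded here. *)
  have e1 : e < 1.
    by have := spectral_radius_ge0 (asgd_op lam eta beta zeta B); lra.
  have e01 : 0 < e < 1 by rewrite e0.
  have Xe : 16 * X <= e.
    apply: le_trans de; have : 0 <= X by rewrite mulr_ge0 ?powR_ge0 //; lra.
    by rewrite /X CE; lra.
  case: Hlam => _ dec.
  have [h1 h2] := asgd_gap_bounds a c1 c2 d lam eta beta zeta e B a_gt1 c1_gt0
    c1_le_c2 d1 B1 dec bnd eta0 b01 z0 e01 rho Xe.
  exact: He.
have dpow x y : x <= y -> d%:R `^ x <= d%:R `^ y :> R by move=> xy; rewrite ler_powR.
have main : 1 - C * B%:R `^ k * d%:R `^ (- (a ^+ 2 / (2 * a - 1)))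
    <= asgd_opt_radius H B.
  apply: gap.
    have h1 : d%:R `^ (- a) <= d%:R `^ (- (a ^+ 2 / (2 * a - 1))) :> R.
      rewrite dpow // lerN2 ler_pdivrMr // expr2 ler_pM2l //; lra.
    have h2 : 1 <= B%:R `^ k :> R by rewrite -[leLHS](powRr0 B%:R) ler_powR // ltW.
    rewrite mulrC -mulrA ler_pM2l // -[leLHS]mul1r ler_pM ?powR_ge0 //.
  set e := _ * _ * _ => e01 _; apply/negP; rewrite -ltNge.
  (* The exponent 2 - 1/a equals 1/k, so this power of e is linear in B d^(-a), with factor C^(1/k)
     >= C > 640 L. *)
  have -> : e `^ (2 - a^-1) = C `^ k^-1 * (B%:R * d%:R `^ (- a)).
    have kE : 2 - a^-1 = k^-1 by rewrite /k; field; rewrite !gt_eqF.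
    rewrite kE /e !powRM ?mulr_ge0 ?powR_ge0 ?(ltW C0) //.
    rewrite -!powRrM divff ?gt_eqF // powRr1 // -mulrA; congr (_ * (_ * _ `^ _)).
    by rewrite /k; field; rewrite !gt_eqF.
  have -> : 640 * X * B%:R = 640 * L * (B%:R * d%:R `^ (- a)).
    by rewrite /X; ring.
  rewrite ltr_pM2r ?mulr_gt0 ?powR_gt0 ?ltr0n //.
  apply: lt_le_trans (_ : C <= _); first by rewrite CE; lra.
  by rewrite le1r_powR // invf_ge1.
split=> _; last 1 first.
(* Case (iii): here e^2 = C^2 d^(-a), which exceeds 64 X since C^2 >= C > 64 L. *)
- apply: gap.
    by rewrite mulrC ler_pM2l // dpow //; lra.
  set e := _ * _ => _ h _; move: h; apply/negP; rewrite -ltNge.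
  have -> : e ^+ 2 = C ^+ 2 * d%:R `^ (- a).
    rewrite /e exprMn -(powR_mulrn 2 (powR_ge0 _ _)) -powRrM; congr (_ * _ `^ _).
    by field.
  rewrite mulrA ltr_pM2r ?powR_gt0 // expr2.
  apply: lt_le_trans (_ : C * 1 <= _); first by rewrite CE; lra.
  by rewrite ler_pM2l.
(* Case (i) follows from the bound of (ii), since k <= 1 and B >= 1 give B^k <= B. *)
- apply: le_trans main; rewrite lerD2l lerN2 ler_pM2r ?powR_gt0 // ler_pM2l //.
  exact: ler1_powR.
- exact: main.
Qed.
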